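(* Let $\{\varphi_n\}_{n=1}^N\subseteq\mathbb{C}^3$ and let $\mathcal{A}\colon\mathbb{C}^3/\mathbb{T}\rightarrow\mathbb{R}^N$ be defined by $(\mathcal{A}(x))(n):=|\langle x,\varphi_n\rangle|^2$. Then the HMW test, applied to $\{\varphi_n\}_{n=1}^N$, correctly determines whether $\mathcal{A}$ is injective; that is, the test outputs ''INJECTIVE'' if $\mathcal{A}$ is injective, and outputs ''NOT INJECTIVE'' if $\mathcal{A}$ is not injective.
   Context: $\mathbb{T}=\{c\in\mathbb{C}:|c|=1\}$. $\mathbb{C}^3/\mathbb{T}$ denotes $\mathbb{C}^3$ with $x$ and $y$ identified whenever $y=cx$ for some $c\in\mathbb{T}$; injectivity of $\mathcal{A}$ means: $\mathcal{A}(x)=\mathcal{A}(y)$ implies $y=cx$ for some $c\in\mathbb{T}$. The inner product is $\langle x,\varphi\rangle=\varphi^*x$. $\mathbb{H}^{3\times3}$ is the real $9$-dimensional vector space of self-adjoint complex $3\times 3$ matrices, and $\langle A,B\rangle_{\mathrm{HS}}=\operatorname{Tr}[B^*A]$ is the Hilbert-Schmidt inner product. The HMW test takes $\{\varphi_n\}_{n=1}^N\subseteq\mathbb{C}^3$ as input and proceeds as follows. Define the real-linear map $\mathbf{A}\colon\mathbb{H}^{3\times3}\rightarrow\mathbb{R}^N$ by $\mathbf{A}H=\{\langle H,\varphi_n\varphi_n^*\rangle_{\mathrm{HS}}\}_{n=1}^N$. If $\dim\operatorname{null}(\mathbf{A})=0$, output ''INJECTIVE''. Otherwise pick any nonzero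 $H\in\operatorname{null}(\mathbf{A})$; if $\dim\operatorname{null}(\mathbf{A})=1$ and $\det(H)\neq0$, output ''INJECTIVE''; else output ''NOT INJECTIVE''. (Dimensions are over $\mathbb{R}$.) *)

(* Defs.v *)
From HB Require Import structures.
From mathcomp Require Import all_boot all_order all_algebra.
From mathcomp Require Import sesquilinear spectral.
From mathcomp Require Import reals.
From mathcomp Require Export complex.

Set Implicit Arguments.
Unset Strict Implicit.
Unset Printing Implicit Defensive.

Import Order.TTheory GRing.Theory Num.Theory.
Local Open Scope ring_scope.
Local Open Scope complex_scope.
Local Open Scope sesquilinear_scope.

(* Vectors of C^d are columns; M^t* is the conjugate transpose. *)

Section Hermitian.
Variables (R : realType) (d : nat).

Definition selfadjoint : {pred 'M[R[i]]_d} := fun H => H \is hermsymmx.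

Lemma selfadjointP (H : 'M[R[i]]_d) :
  reflect (H^t* = H) (H \in selfadjoint).
Proof.
rewrite /selfadjoint unfold_in is_hermitianmxE expr0 scale1r eq_sym.
exact: eqP.
Qed.

Fact selfadjoint_zmod_closed : zmod_closed selfadjoint.
Proof.
split=> [|A B /selfadjointP hA /selfadjointP hB]; apply/selfadjointP.
  by rewrite trmx0 map_mx0.
by rewrite linearB map_mxB /= hA hB.
Qed.
HB.instance Definition _ :=
  GRing.isZmodClosed.Build 'M[R[i]]_d selfadjoint selfadjoint_zmod_closed.

Record herm := Herm {
  herm_val :> 'M[R[i]]_d;
  herm_valP : herm_val \in selfadjoint }.

HB.instance Definition _ := [isSub for herm_val].
HB.instance Definition _ := [Choice of herm by <:].
HB.instance Definition _ := [SubChoice_isSubZmodule of herm by <:].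

(* The complex matrices form a module over R[i] only, and herm is not closed
   under that action: the real vector space structure is built by hand. *)
Fact herm_scale_subproof (a : R) (H : herm) :
  a%:C *: herm_val H \in selfadjoint.
Proof.
apply/selfadjointP; have /selfadjointP hH := herm_valP H.
rewrite linearZ /= map_mxZ hH; congr (_ *: _).
by rewrite -[LHS]/(conjc a%:C) /= oppr0.
Qed.
Definition herm_scale a H := Herm (herm_scale_subproof a H).

Fact herm_scaleA a b H :
  herm_scale a (herm_scale b H) = herm_scale (a * b) H.
Proof. by apply: val_inj; rewrite /= scalerA rmorphM. Qed.
Fact herm_scale1 : left_id 1 herm_scale.
Proof. by move=> H; apply: val_inj; rewrite /= rmorph1 scale1r. Qed.
Fact herm_scaleDr : right_distributive herm_scale +%R.
Proof. by move=> a H K; apply: val_inj; rewrite /= scalerDr. Qed.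
Fact herm_scaleDl H : {morph herm_scale^~ H : a b / a + b}.
Proof. by move=> a b; apply: val_inj; rewrite /= rmorphD scalerDl. Qed.
HB.instance Definition _ := GRing.Zmodule_isLmodule.Build R herm
  herm_scaleA herm_scale1 herm_scaleDr herm_scaleDl.

(* Coordinates: real parts on and above the diagonal, imaginary parts below. *)
Definition herm_coord (H : herm) : 'M[R]_d := \matrix_(i, j)
  if (i <= j)%N then complex.Re (herm_val H i j)
  else complex.Im (herm_val H i j).

Definition herm_of_coord_mx (M : 'M[R]_d) : 'M[R[i]]_d := \matrix_(i, j)
  if (i < j)%N then M i j -i* M j i
  else if (j < i)%N then M j i +i* M i j else (M i i)%:C.

Fact herm_of_coord_subproof M : herm_of_coord_mx M \in selfadjoint.
Proof.
apply/selfadjointP/matrixP=> i j; rewrite !mxE -[LHS]/(conjc _).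
by case: ltngtP => [_|_|/val_inj->] /=; rewrite ?opprK ?oppr0.
Qed.
Definition herm_of_coord M := Herm (herm_of_coord_subproof M).

Lemma hermE (H : herm) i j : herm_val H j i = conjc (herm_val H i j).
Proof.
have /selfadjointP/matrixP/(_ j i) := herm_valP H.
by rewrite !mxE => <-.
Qed.

Lemma herm_coordK : cancel herm_coord herm_of_coord.
Proof.
move=> H; apply/val_inj/matrixP => i j; rewrite /= !mxE.
case: ltngtP => [ij|ij|/val_inj->].
- by rewrite [herm_val H j i]hermE; case: (herm_val H i j) => a b /=; rewrite opprK.
- by rewrite [herm_val H j i]hermE; case: (herm_val H i j).
- have := hermE H j j; case: (herm_val H j j) => a b /= [hb].
  by rewrite leqnn; congr (_ +i* _); apply/esym/eqP; rewrite -eqNr -hb.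
Qed.

Lemma herm_of_coordK : cancel herm_of_coord herm_coord.
Proof.
move=> M; apply/matrixP => i j; rewrite /= !mxE.
by case: ltngtP => [_|_|/val_inj->].
Qed.

Fact herm_vect_iso : Vector.axiom (d * d) herm.
Proof.
exists (mxvec \o herm_coord).
  move=> a H K /=; rewrite -linearP; congr mxvec.
  apply/matrixP=> i j; rewrite !mxE /=.
  case: (herm_val H i j) => x y; case: (herm_val K i j) => z t.
  by case: ifP => _ /=; rewrite mul0r ?subr0 ?addr0.
exists (herm_of_coord \o vec_mx) => x /=.
  by rewrite mxvecK herm_coordK.
by rewrite herm_of_coordK vec_mxK.
Qed.
HB.instance Definition _ := Lmodule_hasFinDim.Build R herm herm_vect_iso.

Lemma dim_herm : \dim {:herm} = (d * d)%N.
Proof. exact: dimvf. Qed.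

End Hermitian.
Arguments selfadjoint {R d} H.

Section PhaseRetrieval.
Variables (R : realType) (d N : nat) (phi : 'I_N -> 'cV[R[i]]_d).

Definition inner (x y : 'cV[R[i]]_d) : R[i] := (y^t* *m x) 0 0.

Definition intensity (x : 'cV[R[i]]_d) : 'rV[R]_N :=
  \row_n Normc.normc (inner x (phi n)) ^+ 2.

(* Injectivity of the map induced by f on C^d / T. *)
Definition injective_mod_phase (T : Type) (f : 'cV[R[i]]_d -> T) : Prop :=
  forall x y, f x = f y -> exists2 c : R[i], `|c| = 1 & y = c *: x.

Lemma intensity_phase (c : R[i]) x :
  `|c| = 1 -> intensity (c *: x) = intensity x.
Proof.
move=> c1; apply/rowP => n; rewrite !mxE /inner -scalemxAr mxE.
by rewrite Normc.normcM -[Normc.normc c]/(complex.Re `|c|) c1 mul1r.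
Qed.

Definition hs_inner (A B : 'M[R[i]]_d) : R[i] := \tr (B^t* *m A).

Lemma hs_inner_real (A B : 'M[R[i]]_d) :
  A \in selfadjoint -> B \in selfadjoint ->
  hs_inner A B = (complex.Re (hs_inner A B))%:C.
Proof.
move=> /selfadjointP hA /selfadjointP hB.
suff : conjc (hs_inner A B) = hs_inner A B.
  case: (hs_inner A B) => a b /= [hb]; congr (_ +i* _).
  by apply/eqP; rewrite -eqNr hb.
rewrite -[LHS]/(Num.conj _) /hs_inner hB -trace_map_mx map_mxM.
by rewrite -mxtrace_tr trmx_mul !map_trmx hA hB mxtrace_mulC.
Qed.

(* By hs_inner_real, taking the real part only moves a real number of R[i]
   into R. *)
Definition lifted (H : herm R d) : 'rV[R]_N :=
  \row_n complex.Re (hs_inner (herm_val H) (phi n *m (phi n)^t*)).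

Fact lifted_is_linear : linear lifted.
Proof.
move=> a H K; apply/rowP => n; rewrite !mxE /hs_inner /=.
rewrite mulmxDr -scalemxAr linearD linearZ /=.
by case: (\tr _) => x y; case: (\tr _) => z t /=; rewrite mul0r subr0.
Qed.
HB.instance Definition _ :=
  GRing.isLinear.Build R (herm R d) 'rV[R]_N _ lifted lifted_is_linear.

End PhaseRetrieval.

Inductive verdict := INJECTIVE | NOT_INJECTIVE.

(* pick resolves the choice of a nonzero element of the null space. *)
Definition HMW_test (R : realType) (pick : {vspace herm R 3} -> herm R 3)
    (N : nat) (phi : 'I_N -> 'cV[R[i]]_3) : verdict :=
  let K := lker (linfun (lifted phi)) in
  if \dim K == 0%N then INJECTIVE
  else let H := pick K in
    if (\dim K == 1%N) && (\det (herm_val H) != 0) then INJECTIVE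
    else NOT_INJECTIVE.

(* Main.v *)
(* Since the lift of x x^* is the intensity of x, two vectors with equal
   intensities give a null matrix x x^* - y y^*, of rank at most 2.  Conversely
   a singular 3x3 null matrix diagonalizes to +- x x^* +- y y^*; injectivity
   then forces it to vanish, in the definite case by comparing x and y with 0.
   So injectivity means that 0 is the only singular null matrix.  A null space
   of dimension at least 2 always violates this, because det is odd in odd
   dimension, and one of dimension 1 violates it iff its generator is singular. *)
Require Import Defs.
From mathcomp Require Import all_boot all_order all_algebra.
From mathcomp Require Import sesquilinear spectral.
From mathcomp Require Import ring reals complex.

Import Order.TTheory GRing.Theory Num.Theory.
Local Open Scope ring_scope.
Local Open Scope complex_scope.
Local Open Scope sesquilinear_scope.

Fact outer_subproof (R : realType) d (x : 'cV[R[i]]_d) :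
  x *m x^t* \in selfadjoint.
Proof. by apply/selfadjointP; rewrite trmx_mul map_mxM /= trmxCK. Qed.

Definition outer (R : realType) d (x : 'cV[R[i]]_d) : herm R d :=
  Herm (outer_subproof R d x).
Arguments outer {R d} x.

Lemma outerZ (R : realType) d (c : R[i]) (x : 'cV[R[i]]_d) :
  outer (c *: x) = Normc.normc c ^+ 2 *: outer x.
Proof.
apply: val_inj => /=; rewrite linearZ /= map_mxZ -scalemxAl -scalemxAr scalerA.
by rewrite -normCK rmorphXn.
Qed.

Lemma outer_phase (R : realType) d (x y : 'cV[R[i]]_d) :
  outer x = outer y -> exists2 c : R[i], `|c| = 1 & y = c *: x.
Proof.
move=> /(congr1 (@herm_val _ _))/matrixP /= xy.
have {}xy j k : x j 0 * (x k 0)^*%R = y j 0 * (y k 0)^*%R.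
  by have := xy j k; rewrite !mxE !big_ord1 !mxE.
have nxy k : `|x k 0| = `|y k 0|.
  by apply/eqP; rewrite -(@eqrXn2 _ 2) // !normCK xy.
have [/existsP [k xk0]|/existsPn x0] := boolP [exists k, x k 0 != 0]; last first.
  exists 1; rewrite ?normr1 // scale1r; apply/colP => j.
  have /negPn/eqP xj0 := x0 j; apply/eqP.
  by rewrite xj0 -normr_eq0 -nxy xj0 normr0.
have yk0 : y k 0 != 0 by rewrite -normr_eq0 -nxy normr_eq0.
have cyk0 : (y k 0)^*%R != 0 by rewrite conjC_eq0.
(* Column [k] of the two outer products reads x_j conj(x_k) = y_j conj(y_k); solving for y_j gives
   this phase. *)
exists ((x k 0)^*%R / (y k 0)^*%R).
  by rewrite normf_div !norm_conjC nxy divff // normr_eq0.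
apply/colP => j; rewrite mxE; apply: (mulIf cyk0).
by rewrite -xy mulrC mulrAC divfK.
Qed.

(** The difference factors through a space of dimension 2, so its rank is below 3. *)
Lemma det_outerB (R : realType) (x y : 'cV[R[i]]_3) :
  \det (herm_val (outer x - outer y)) = 0.
Proof.
have -> : herm_val (outer x - outer y) =
    row_mx x (- y) *m col_mx (x^t*) (y^t*).
  by rewrite mul_row_col mulNmx.
apply/eqP/negPn; rewrite -unitfE -unitmxE -row_free_unit -row_leq_rank.
by rewrite -ltnNge ltnS mulmx_max_rank.
Qed.

Lemma det_herm_real (R : realType) d (H : herm R d) :
  (complex.Re (\det (herm_val H)))%:C = \det (herm_val H).
Proof.
apply: RRe_real; rewrite CrealE -det_map_mx -det_tr map_trmx.
by have /selfadjointP -> := herm_valP H.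
Qed.

(** Spectral theorem with real eigenvalues: from H = P^* D P with P unitary, [u k] is the adjoint of
    row [k] of P. The determinant is recorded so that singularity yields a zero among the [a k]. *)
Lemma herm_spectral (R : realType) d (H : herm R d) :
  exists (a : 'I_d -> R) (u : 'I_d -> 'cV[R[i]]_d),
    H = \sum_k a k *: outer (u k) /\
    \det (herm_val H) = (\prod_k a k)%:C.
Proof.
have hH : herm_val H \is hermsymmx := herm_valP H.
set P := spectralmx (herm_val H); set D := spectral_diag (herm_val H).
have HE : herm_val H = invmx P *m diag_mx D *m P.
  exact/orthomx_spectralP/hermitian_normalmx.
have Pu : P \in unitmx := spectral_unit (herm_val H).
have DE k : (complex.Re (D 0 k))%:C = D 0 k.
  by apply: RRe_real; apply: (mxOverP (hermitian_spectral_diag_real hH)).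
exists (fun k => complex.Re (D 0 k)), (fun k => (row k P)^t*); split.
  apply: val_inj => /=; rewrite HE (invmx_unitary (spectral_unitarymx _)).
  rewrite (big_morph (@herm_val R d) (id1 := 0) (op1 := +%R)) //.
  apply/matrixP => i j; rewrite !mxE summxE; apply: eq_bigr => k _.
  by rewrite mul_mx_diag !mxE big_ord1 !mxE -{1}DE conjCK -mulrA mulrCA.
rewrite HE !det_mulmx det_inv det_diag mulrAC mulVr ?mul1r; last first.
  by rewrite -unitmxE.
by rewrite rmorph_prod; apply: eq_bigr => k _; apply: esym; apply: DE.
Qed.

Lemma lifted_outer (R : realType) d N (phi : 'I_N -> 'cV[R[i]]_d) x :
  lifted phi (outer x) = intensity phi x.
Proof.
apply/rowP => n; rewrite !mxE /hs_inner /inner /=.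
set f := phi n; rewrite trmx_mul map_mxM /= trmxCK.
(* By cyclicity the trace of f f^* x x^* is that of the 1x1 matrix (x^* f)(f^* x). *)
rewrite mxtrace_mulC -mulmxA mxtrace_mulC mulmxA -mulmxA /mxtrace big_ord1.
have -> : (x^t* *m f *m (f^t* *m x)) 0 0 = `|(f^t* *m x) 0 0| ^+ 2.
  rewrite mxE big_ord1 normCK mulrC; congr (_ * _).
  rewrite !mxE rmorph_sum; apply: eq_bigr => k _.
  by rewrite !mxE rmorphM mulrC; congr (_ * _); apply: esym; apply: conjCK.
by rewrite -rmorphXn.
Qed.

Lemma singular_herm3 (R : realType) (H : herm R 3) :
  \det (herm_val H) = 0 ->
  exists a b x y, H = a *: outer x + b *: outer y.
Proof.
have [a [u [-> ->]]] := herm_spectral R 3 H.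
move=> /complexI/eqP/prodf_eq0[k _ /eqP ak].
(* A zero eigenvalue at [k] leaves only the two indices other than [k]. *)
pose i := lift k (0 : 'I_2); pose j := lift k (1 : 'I_2).
exists (a i), (a j), (u i), (u j).
rewrite (bigD1_ord k) //= ak scale0r add0r big_ord_recl big_ord1.
by congr (_ + a (lift _ _) *: outer (u (lift _ _))); apply: val_inj.
Qed.

(** The square root of |a| is absorbed into the vector; only the sign of [a] survives. *)
Lemma signed_outer (R : realType) d (a : R) (x : 'cV[R[i]]_d) :
  exists y, a *: outer x = outer y \/ a *: outer x = - outer y.
Proof.
have sq b : 0 <= b -> b *: outer x = outer ((Num.sqrt b)%:C *: x).
  move=> b0; rewrite outerZ /= expr0n /= addr0 sqrtr_sqr.
  by rewrite ger0_norm ?sqrtr_ge0 // sqr_sqrtr.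
have [a0|a0] := lerP 0 a.
  by exists ((Num.sqrt a)%:C *: x); left; apply: sq.
exists ((Num.sqrt (- a))%:C *: x); right.
by rewrite -sq ?oppr_ge0 ?ltW // scaleNr opprK.
Qed.

Lemma injective_null_singular (R : realType) N (phi : 'I_N -> 'cV[R[i]]_3) :
  injective_mod_phase (intensity phi) ->
  forall H, lifted phi H = 0 -> \det (herm_val H) = 0 -> H = 0.
Proof.
move=> inj.
have outer0 : outer 0 = 0 :> herm R 3.
  by apply: val_inj; rewrite /= mul0mx.
have inj_outer x y : intensity phi x = intensity phi y -> outer x = outer y.
  case/inj => c c1 ->.
  by rewrite outerZ -[Normc.normc c]/(complex.Re `|c|) c1 expr1n scale1r.
(* Intensities are nonnegative, so a zero sum forces [x] and [y] to have the intensities of 0. *)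
have inj_sum x y : intensity phi x + intensity phi y = 0 ->
    outer x + outer y = 0.
  move=> /rowP xy0.
  have sq0 n : intensity phi x 0 n = 0 /\ intensity phi y 0 n = 0.
    have := xy0 n; rewrite !mxE => /eqP.
    by rewrite paddr_eq0 ?sqr_ge0 // => /andP[/eqP -> /eqP ->].
  have i0 : intensity phi 0 = 0.
    by rewrite -lifted_outer outer0 linear0.
  rewrite (inj_outer x 0) ?(inj_outer y 0) ?outer0 ?addr0 //;
    by apply/rowP => n; rewrite i0 [RHS]mxE; case: (sq0 n).
move=> H H0 /singular_herm3 [a [b [x [y HE]]]]; move: H0; rewrite {}HE.
have [x' ax] := signed_outer R 3 a x; have [y' b_y] := signed_outer R 3 b y.
(* The sign patterns come in the order ++, +-, -+, --. *)
case: ax b_y => -> [] ->; rewrite ?linearD ?linearN /= !lifted_outer.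
- exact: inj_sum.
- by move=> /subr0_eq/inj_outer ->; rewrite subrr.
- by rewrite addrC => /subr0_eq/inj_outer ->; rewrite addrC subrr.
- by rewrite -!opprD => /eqP; rewrite oppr_eq0 => /eqP/inj_sum ->; rewrite oppr0.
Qed.

Lemma null_singular_injective (R : realType) N (phi : 'I_N -> 'cV[R[i]]_3) :
  (forall H, lifted phi H = 0 -> \det (herm_val H) = 0 -> H = 0) ->
  injective_mod_phase (intensity phi).
Proof.
move=> null0 x y xy; apply: outer_phase; apply/subr0_eq/null0.
  by rewrite linearB /= !lifted_outer xy subrr.
exact: det_outerB.
Qed.

(** Holds because powers of a real point are real. It turns the determinant along a real path into a
    real polynomial, to which the intermediate value theorem applies. *)
Lemma horner_map_Re (R : rcfType) (p : {poly R[i]}) (t : R) :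
  (map_poly (@complex.Re R) p).[t] = complex.Re p.[t%:C].
Proof.
rewrite (horner_coef_wide _ (size_poly _ _)) horner_coef.
rewrite (big_morph (@complex.Re R) (id1 := 0) (op1 := +%R)) //; last first.
  by case=> a b [].
apply: eq_bigr => k _; rewrite coef_map_id0 // -rmorphXn.
by case: (p`_k) => a b /=; rewrite mulr0 subr0.
Qed.

(* For odd d the path (1 - 2t) H + t (1 - t) K runs from H to - H without
   passing through 0, so the determinant changes sign along it. *)
Lemma singular_in_plane (R : realType) d (V : {vspace herm R d}) :
  odd d -> (1 < \dim V)%N ->
  exists H, [/\ H \in V, H != 0 & \det (herm_val H) = 0].
Proof.
move=> d_odd V1; set H := vpick V.
have H0 : H != 0.
  by rewrite vpick0; apply: contraTneq V1 => ->; rewrite dimv0.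
have /subvPn[K KV KH] : ~~ (V <= <[H]>)%VS.
  by apply: contraL V1 => /dimvS; rewrite dim_vline H0 -leqNgt.
pose g (t : R) : herm R d := (1 - 2 * t) *: H + (t * (1 - t)) *: K.
have gV t : g t \in V by rewrite memvD ?memvZ ?memv_pick.
(* If t(1 - t) is nonzero, [g t = 0] would put K on the line of H; otherwise t is 0 or 1 and [g t]
   is H or - H. *)
have g0 t : g t != 0.
  apply: contraNneq KH => gt0.
  have [t01|t01] := eqVneq (t * (1 - t)) 0; last first.
    rewrite -(scalerK t01 K) memvZ //.
    move/eqP: gt0; rewrite /g addrC addr_eq0 => /eqP ->.
    by rewrite memvN memvZ // memv_line.
  move: gt0; rewrite /g t01 scale0r addr0 => /eqP.
  rewrite scaler_eq0 (negPf H0) orbF; move/eqP: t01.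
  rewrite mulf_eq0 => /orP[/eqP ->|/eqP t1].
    by rewrite mulr0 subr0 oner_eq0.
  have -> : 1 - 2 * t = -1 by rewrite -(subr0_eq t1); ring.
  by rewrite oppr_eq0 oner_eq0.
pose M : 'M[{poly R[i]}]_d := (1 - 2 * 'X) *: map_mx polyC (herm_val H)
  + ('X * (1 - 'X)) *: map_mx polyC (herm_val K).
pose q := map_poly (@complex.Re R) (\det M).
have qE t : q.[t] = complex.Re (\det (herm_val (g t))).
  rewrite horner_map_Re -[_.[_]]/(horner_eval _ _) -det_map_mx.
  congr (complex.Re (\det _)); apply/matrixP => i j.
  rewrite !mxE /= /horner_eval !hornerE.
  by rewrite !rmorphM !rmorphB !rmorphM rmorph1 rmorph_nat.
have q01 : q.[1] = - q.[0].
  rewrite !qE /g mulr0 !subr0 mul0r scale0r addr0 scale1r subrr mulr0 scale0r.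
  have -> : 1 - 2 * 1 = -1 :> R by ring.
  rewrite addr0 scaleN1r /= -scaleN1r detZ -signr_odd d_odd expr1 mulN1r.
  by case: (\det _).
have [t qt0] : exists t, root q t.
  (* [poly_ivt] wants a value at most 0 on the left and at least 0 on the right, so [q] is negated
     when it starts positive. *)
  have [q0|q0] := lerP q.[0] 0.
    have [||t _ qt0] := @poly_ivt _ q 0 1; rewrite ?ler01 ?q0 ?q01 ?oppr_ge0 //.
    by exists t.
  have [||t _ qt0] := @poly_ivt _ (- q) 0 1; rewrite ?ler01 //.
    by rewrite !hornerN q01 opprK oppr_le0 ltW.
  by exists t; rewrite -rootN.
(* The determinant of a self-adjoint matrix is real, so the vanishing of its real part suffices. *)
exists (g t); split=> //; rewrite -det_herm_real -qE.
by have /rootP -> := qt0.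
Qed.

Theorem theorem11 (R : realType) (N : nat) (phi : 'I_N -> 'cV[R[i]]_3)
    (pick : {vspace herm R 3} -> herm R 3)
    (pickP : forall K : {vspace herm R 3}, K != 0%VS ->
               pick K \in K /\ pick K != 0) :
  (injective_mod_phase (intensity phi) -> HMW_test pick phi = INJECTIVE) /\
  (~ injective_mod_phase (intensity phi) ->
     HMW_test pick phi = NOT_INJECTIVE).
Proof.
set K := lker (linfun (lifted phi)).
have memK H : (H \in K) = (lifted phi H == 0) by rewrite memv_ker lfunE.
rewrite /HMW_test -/K; have [K0|K0] := eqVneq (\dim K) 0%N.
  split=> //; case; apply: null_singular_injective => H /eqP.
  rewrite -memK; move/eqP: K0; rewrite dimv_eq0 => /eqP ->.
  by rewrite memv0 => /eqP.
have [|pK p0] := pickP K; first by rewrite -dimv_eq0.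
split=> [inj|ninj].
  have null0 H : H \in K -> \det (herm_val H) = 0 -> H = 0.
    by rewrite memK => /eqP; apply: injective_null_singular.
  case: ifP => //; move/negbT; rewrite negb_and negbK => /orP[K1|/eqP dp].
    (* The dimension is neither 0 nor 1, hence at least 2; [isT] proves that 3 is odd. *)
    have [|H [HK /eqP H0 dH]] := @singular_in_plane _ _ K isT.
      by rewrite ltn_neqAle eq_sym K1 lt0n.
    by case: H0; apply: null0.
  by case/eqP: p0; apply: null0.
case: ifP => // /andP[/eqP K1 dp]; case: ninj.
apply: null_singular_injective => H /eqP; rewrite -memK => HK dH.
(* Every null matrix is a real multiple c of [pick K], with determinant c^3 times a nonzero number;
   if singular, it has c = 0. *)
have KE : K = <[pick K]>%VS.
  by apply/esym/eqP; rewrite eqEdim -memvE pK dim_vline p0 K1.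
move: HK; rewrite KE => /vlineP[c HE]; move: dH; rewrite {}HE /= detZ.
move/eqP; rewrite mulf_eq0 (negPf dp) orbF expf_eq0 /= => /eqP/complexI ->.
by rewrite scale0r.
Qed.
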